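(* Let the $q$-hypergeometric Euler numbers $\mathcal E_{N,k}$ be defined by $\sum_{k=0}^\infty\mathcal E_{N,k}\frac{x^k}{k!}=\left(\sum_{n=0}^\infty\frac{[2N]_q!\,x^{2n}}{[2N+2n]_q!}\right)^{-1}$. For all integers $N\ge 0$ and $n\ge 1$, $$\mathcal E_{N,2n}=(-1)^n(2n)!\begin{vmatrix} \frac{[2N]_q!}{[2N+2]_q!}&1&0&&\\ \frac{[2N]_q!}{[2N+4]_q!}&\frac{[2N]_q!}{[2N+2]_q!}&1&&\\ \vdots&\vdots&\ddots&1&0\\ \frac{[2N]_q!}{[2N+2n-2]_q!}&\frac{[2N]_q!}{[2N+2n-4]_q!}&\cdots&\frac{[2N]_q!}{[2N+2]_q!}&1\\ \frac{[2N]_q!}{[2N+2n]_q!}&\frac{[2N]_q!}{[2N+2n-2]_q!}&\cdots&\frac{[2N]_q!}{[2N+4]_q!}&\frac{[2N]_q!}{[2N+2]_q!} \end{vmatrix},$$ where the $n\times n$ matrix has $(i,j)$ entry $\frac{[2N]_q!}{[2N+2(i-j+1)]_q!}$ if $i\ge j$, $1$ if $j=i+1$, and $0$ if $j>i+1$.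
   Context: $q\ne 1$ is a complex number that is not a root of unity; $[n]_q=\frac{1-q^n}{1-q}$, $[n]_q!=[n]_q[n-1]_q\cdots[1]_q$ for $n\ge1$, and $[0]_q!=1$. Generating functions are formal power series in $x$. *)

(* Defs.v *)
From HB Require Import structures.
From mathcomp Require Import all_boot all_order all_algebra.
From mathcomp Require Import reals complex.

Set Implicit Arguments.
Unset Strict Implicit.
Unset Printing Implicit Defensive.

Import Order.TTheory GRing.Theory Num.Theory.
Local Open Scope ring_scope.

(* A formal power series \sum_k a_k x^k is represented by its sequence of
   coefficients a : nat -> K. *)
Section FormalPowerSeries.
Variable K : fieldType.
Implicit Types a b : nat -> K.

Definition fps_one : nat -> K := fun k => (k == 0%N)%:R.

Definition fps_mul a b : nat -> K :=
  fun n => \sum_(i < n.+1) a i * b (n - i)%N.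

Fixpoint fps_inv_coefs a (n : nat) : seq K :=
  if n is m.+1 then
    let s := fps_inv_coefs a m in
    rcons s (- (a 0%N)^-1 * \sum_(i < m.+1) s`_i * a (m.+1 - i)%N)
  else [:: (a 0%N)^-1].

(* The multiplicative inverse of a series with nonzero constant coefficient,
   see fps_invP; if a 0 = 0 the value is meaningless. *)
Definition fps_inv a : nat -> K := fun n => (fps_inv_coefs a n)`_n.

Lemma size_fps_inv_coefs a n : size (fps_inv_coefs a n) = n.+1.
Proof. by elim: n => //= n IHn; rewrite size_rcons IHn. Qed.

Lemma nth_fps_inv_coefs a n i :
  (i <= n)%N -> (fps_inv_coefs a n)`_i = fps_inv a i.
Proof.
elim: n => [|n IHn]; first by case: i.
rewrite leq_eqVlt => /predU1P[-> //|lt_i_n].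
by rewrite /= nth_rcons size_fps_inv_coefs lt_i_n IHn.
Qed.

Lemma fps_invS a n :
  fps_inv a n.+1 =
    - (a 0%N)^-1 * \sum_(i < n.+1) fps_inv a i * a (n.+1 - i)%N.
Proof.
rewrite {1}/fps_inv /= nth_rcons size_fps_inv_coefs ltnn eqxx.
by congr (_ * _); apply: eq_bigr => i _; rewrite nth_fps_inv_coefs // -ltnS.
Qed.

Lemma fps_invP a b :
  a 0%N != 0 -> fps_mul b a =1 fps_one <-> b =1 fps_inv a.
Proof.
move=> a0; split=> [ba1 n | ba].
  elim/ltn_ind: n => -[|n] IHn; have := ba1 _; rewrite /fps_mul /fps_one.
    move/(_ 0%N); rewrite big_ord1 subn0 /= /fps_inv /= => ba0.
    by apply: (mulIf a0); rewrite ba0 mulVf.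
  move/(_ n.+1); rewrite big_ord_recr /= subnn mulr0n => ba0.
  rewrite fps_invS; apply: (mulIf a0); rewrite mulrAC mulNr mulVf // mulN1r.
  apply/eqP; rewrite -addr_eq0 addrC; apply/eqP; rewrite -[RHS]ba0.
  by congr (_ + _); apply: eq_bigr => i _; rewrite IHn.
case=> [|n]; rewrite /fps_mul /fps_one.
  by rewrite big_ord1 subn0 ba /fps_inv /= mulVf.
rewrite big_ord_recr /= subnn (eq_bigr _ (fun i _ => congr1 ( *%R^~ _) (ba _))).
by rewrite ba fps_invS mulrAC mulNr mulVf // mulN1r subrr.
Qed.

End FormalPowerSeries.

Section QNumbers.
Variable K : fieldType.
Variable q : K.

Definition qnat (n : nat) : K := (1 - q ^+ n) / (1 - q).

Definition qfact (n : nat) : K := \prod_(1 <= i < n.+1) qnat i.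

Lemma qfact_neq0 n :
  (forall m : nat, (0 < m)%N -> ~~ m.-unity_root q) -> qfact n != 0.
Proof.
move=> qN1; have q1 m : (0 < m)%N -> 1 - q ^+ m != 0.
  by move=> /qN1; rewrite unity_rootE subr_eq0 eq_sym.
rewrite /qfact big_nat prodf_seq_neq0; apply/allP => i _; apply/implyP.
case/andP=> i0 _; rewrite mulf_neq0 ?invr_neq0 ?q1 //.
by rewrite -(expr1 q) q1.
Qed.

(* \sum_n [2N]_q! / [2N + 2n]_q! x^(2n) *)
Definition qhEuler_series (N : nat) : nat -> K :=
  fun k => if odd k then 0 else qfact (2 * N) / qfact (2 * N + k).

Definition qhEuler (N k : nat) : K :=
  k`!%:R * fps_inv (qhEuler_series N) k.

End QNumbers.

(* The series \sum_k qhEuler q N k / k! x^k times qhEuler_series q N is 1. *)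
Lemma qhEuler_gf (K : numFieldType) (q : K) (N : nat) :
  (forall m : nat, (0 < m)%N -> ~~ m.-unity_root q) ->
  fps_mul (fun k => qhEuler q N k / k`!%:R) (qhEuler_series q N)
    =1 @fps_one K.
Proof.
move=> qN1; apply/fps_invP => [|k].
  by rewrite /qhEuler_series /= addn0 divff ?oner_eq0 // qfact_neq0.
by rewrite /qhEuler mulrAC divff ?mul1r // pnatr_eq0 -lt0n fact_gt0.
Qed.

(* Main.v *)
Require Import Defs.
From mathcomp Require Import all_boot all_order all_algebra.
From mathcomp Require Import reals complex.

(** The series [qhEuler_series q N] is even, so it is a series in x^2 with
    constant term 1, and the even coefficients of its inverse form the inverse
    of that series in x^2 ([fps_mul_even_inv]).  It remains to express the
    coefficients b of the inverse of a series a with a 0 = 1 by determinants.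
    The equations for b 0, ..., b n form a linear system whose matrix is the
    lower unitriangular Toeplitz matrix (a (i - j)), of determinant 1, and whose
    right-hand side is the first basis vector.  By Cramer's rule b n is the
    cofactor at row 0 and column n ([fps_inv_hessenberg_det]).  Deleting that
    row and that column shifts the Toeplitz matrix up by one, which puts the
    ones of its diagonal above the diagonal: this is the Hessenberg matrix of
    the theorem, and (-1)^n is the sign of the cofactor. *)

Set Implicit Arguments.
Unset Strict Implicit.
Unset Printing Implicit Defensive.

Import Order.TTheory GRing.Theory Num.Theory.
Local Open Scope ring_scope.

Definition toeplitz_mx (K : fieldType) (a : nat -> K) n : 'M[K]_n :=
  \matrix_(i, j) if (j <= i)%N then a (i - j)%N else 0.

Lemma det_toeplitz_mx (K : fieldType) (a : nat -> K) n :
  \det (toeplitz_mx a n) = a 0%N ^+ n.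
Proof.
rewrite det_trig => [|]; last first.
  by apply/is_trig_mxP => i j lt_ij; rewrite mxE leqNgt lt_ij.
rewrite (eq_bigr (fun=> a 0%N)) => [|i _]; last by rewrite mxE leqnn subnn.
by rewrite prodr_const card_ord.
Qed.

(** The first n coefficients of a product depend only on the first n
    coefficients of the factors, through a matrix-vector product. *)
Lemma toeplitz_mxM (K : fieldType) (a b : nat -> K) n :
  toeplitz_mx a n *m \col_j b j = \col_i fps_mul b a i.
Proof.
apply/colP => i; rewrite !mxE /fps_mul.
rewrite (big_ord_widen n (fun j => b j * a (i - j)%N)) // [RHS]big_mkcond /=.
by apply: eq_bigr => j _; rewrite !mxE ltnS; case: ifP; rewrite ?mul0r // mulrC.
Qed.

(** Cramer's rule for the Toeplitz system that determines b 0, ..., b n; the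
    determinant of the system is 1. *)
Lemma fps_inv_hessenberg_det (K : fieldType) (a b : nat -> K) n :
    a 0%N = 1 -> fps_mul b a =1 @fps_one K ->
  b n = (-1) ^+ n *
    \det (\matrix_(i < n, j < n) if (j <= i.+1)%N then a (i.+1 - j)%N else 0).
Proof.
move=> a0 ba1; pose A := toeplitz_mx a n.+1.
have solA : \col_(j < n.+1) b j = \adj A *m delta_mx 0 (0 : 'I_1).
  have <- : A *m \col_j b j = delta_mx 0 0.
    by rewrite toeplitz_mxM; apply/colP => i; rewrite !mxE ba1 eqxx andbT.
  by rewrite mulmxA mul_adj_mx det_toeplitz_mx a0 expr1n mul1mx.
have /colP/(_ ord_max) := solA; rewrite -colE !mxE /= => ->.
rewrite /cofactor add0n; congr (_ * \det _).
by apply/matrixP => i j; rewrite !mxE lift0 lift_max.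
Qed.

Lemma sum_even_ord (K : fieldType) (f : nat -> K) n :
    (forall i, (i <= 2 * n)%N -> odd i -> f i = 0) ->
  \sum_(i < (2 * n).+1) f i = \sum_(i < n.+1) f (2 * i)%N.
Proof.
elim: n => [|n IHn] f_odd; first by rewrite !big_ord1.
rewrite [RHS]big_ord_recr /= -IHn => [|i le_i]; last first.
  by apply: f_odd; rewrite (leq_trans le_i) // leq_mul2l leqnSn.
rewrite mulnS !big_ord_recr /= [f _.+1]f_odd ?addr0 ?mulnS //=.
by rewrite oddM.
Qed.

(** In the coefficient of x^(2n) of b * a an odd index of b is paired with an
    odd index of a, so only even coefficients of b contribute. *)
Lemma fps_mul_even_inv (K : fieldType) (a b : nat -> K) :
    (forall i, odd i -> a i = 0) -> fps_mul b a =1 @fps_one K ->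
  fps_mul (fun i => b (2 * i)%N) (fun i => a (2 * i)%N) =1 @fps_one K.
Proof.
move=> a_odd ba1 n; have := ba1 (2 * n)%N.
have -> : fps_one K (2 * n) = fps_one K n by rewrite /fps_one muln_eq0.
move=> <-; rewrite /fps_mul.
rewrite (@sum_even_ord _ (fun i => b i * a (2 * n - i)%N)) => [|i le_i i_odd].
  by apply: eq_bigr => i _; rewrite mulnBr.
by rewrite a_odd ?mulr0 // oddB // oddM i_odd.
Qed.

Theorem theorem6 (R : realType) (q : R[i]) (q_neq1 : q != 1)
    (q_not_unity_root : forall m : nat, (0 < m)%N -> ~~ m.-unity_root q)
    (N n : nat) (n_gt0 : (0 < n)%N) :
  qhEuler q N (2 * n) =
    (-1) ^+ n * ((2 * n)`!)%:R *
    \det (\matrix_(i < n, j < n)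
            if (j <= i)%N then
              qfact q (2 * N) / qfact q (2 * N + 2 * (i - j + 1))
            else if (j : nat) == i.+1 then 1 else 0).
Proof.
pose a := qhEuler_series q N.
have a0 : a 0%N = 1.
  by rewrite /a /qhEuler_series /= addn0 divff // qfact_neq0.
have a_even m : a (2 * m)%N = qfact q (2 * N) / qfact q (2 * N + 2 * m).
  by rewrite /a /qhEuler_series oddM.
have a_odd i : odd i -> a i = 0 by rewrite /a /qhEuler_series => ->.
have inv_a : fps_mul (fps_inv a) a =1 @fps_one _.
  by apply/fps_invP; rewrite // a0 oner_neq0.
have a20 : a (2 * 0)%N = 1 by rewrite muln0.
have inv_a2 := fps_mul_even_inv a_odd inv_a.
have hess := @fps_inv_hessenberg_det _ (fun i => a (2 * i)%N) _ n a20 inv_a2.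
rewrite /qhEuler -/a hess.
rewrite mulrA [_%:R * _]mulrC; congr (_ * \det _).
apply/matrixP => i j; rewrite !mxE -a_even.
have [le_ji | lt_ij] := leqP j i; first by rewrite leqW // addn1 subSn.
by rewrite leq_eqVlt ltnS leqNgt lt_ij orbF; case: eqP => // ->; rewrite subnn.
Qed.
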